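(* Let $\mu_n$ and $\sigma_n^2$ be the expected value and the variance of the random variable $X_n$. Then $$\lim_{n\to\infty}\frac{\mu_n}{n}=\frac25\left(\varphi-\frac12\right)=\frac{1}{\sqrt5},$$ $$\lim_{n\to\infty}\frac{\sigma_n^2}{n}=\frac{4}{25}\left(\varphi-\frac12\right)=\frac25\,\frac{1}{\sqrt5},$$ where $\varphi=\frac{1+\sqrt5}{2}$ is the golden ratio.
   Context: The polynomials $Q_n(x)$ are defined by $Q_0(x)=1$ and $Q_n(x)=x\sum_{k=1}^n k\,Q_{n-k}(x)$ for $n\ge 1$. The numbers $A_{n,k}$ are their coefficients: $Q_n(x)=\sum_{k=0}^n A_{n,k}x^k$. For $n\ge1$ and $0\le k\le n$ one has $A_{n,k}=\binom{n+k-1}{2k-1}$, with $A_{n,0}=0$. For $n\ge1$, $X_n$ is a random variable with values in $\{0,1,\dots,n\}$ and $P(X_n=k)=A_{n,k}/\sum_{m=0}^n A_{n,m}$. *)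

(* Defs.v *)
From HB Require Import structures.
From mathcomp Require Import all_boot all_order all_algebra.
From mathcomp Require Import all_classical all_reals all_analysis.
Import Order.TTheory GRing.Theory Num.Theory.
Import numFieldNormedType.Exports.

Set Implicit Arguments.
Unset Strict Implicit.
Unset Printing Implicit Defensive.

Local Open Scope ring_scope.

(* The table [:: Q_0; ...; Q_n]: the recurrence for Q_n uses all the previous
   values, so it is not directly structural; see Q0 and QE below. *)
Fixpoint Qtable (n : nat) : seq {poly int} :=
  if n is m.+1 then
    rcons (Qtable m)
      ('X * \sum_(1 <= k < m.+2) k%:R * nth 0 (Qtable m) (m.+1 - k))
  else [:: 1].

Definition Q (n : nat) : {poly int} := nth 0 (Qtable n) n.

Definition A (n k : nat) : int := (Q n)`_k.

Definition golden_ratio {R : realType} : R := (1 + Num.sqrt 5) / 2.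

Lemma size_Qtable n : size (Qtable n) = n.+1.
Proof. by elim: n => //= n IHn; rewrite size_rcons IHn. Qed.

Lemma nth_Qtable n i : (i <= n)%N -> nth 0 (Qtable n) i = Q i.
Proof.
elim: n => [|n IHn]; first by rewrite leqn0 => /eqP ->.
rewrite leq_eqVlt => /predU1P[-> //|lein].
by rewrite /= nth_rcons size_Qtable lein IHn.
Qed.

Lemma Q0 : Q 0 = 1.
Proof. by []. Qed.

Lemma QE n : (0 < n)%N -> Q n = 'X * \sum_(1 <= k < n.+1) k%:R * Q (n - k).
Proof.
case: n => // n _; rewrite {1}/Q /= nth_rcons size_Qtable ltnn eqxx.
congr (_ * _); apply: eq_big_nat => k /andP[k_gt0 _].
by rewrite nth_Qtable// leq_subLR -(addn1 n) addnC leq_add2r.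
Qed.

(* Main.v *)
Require Import Defs.
From HB Require Import structures.
From mathcomp Require Import all_boot all_order all_algebra.
From mathcomp Require Import all_classical all_reals all_analysis.
From mathcomp Require Import ring lra.
Import Order.TTheory GRing.Theory Num.Theory.
Import numFieldNormedType.Exports.

Local Open Scope classical_set_scope.
Local Open Scope ring_scope.

(** For [n >= 1] the law of [X n] has generating polynomial [Q n / (Q n).[1]],
so its first two moments are the values at 1 of the Euler operator [x d/dx]
applied once and twice to [Q n], divided by [(Q n).[1]].

Two differences turn the convolution defining [Q] into the linear recurrence
[Q (n+2) = (2 + x) Q (n+1) - Q n] for [n >= 1] ([Q_Qlin]).  At 1 it becomes the
recurrence [u (n+2) = 3 u (n+1) - u n] of the even-indexed Fibonacci numbers,
and the Euler operator, being a derivation, adds forcing terms.  Hence, with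
[a = F_(2n)] and [l = L_(2n)] (Fibonacci and Lucas numbers), the values at 1
of [Q n] and of its first and second Euler derivatives are [a], [b] and [m]
with
  [5 b = n l + 2 a] and [25 m = 5 n^2 a + 6 n l + 2 a]
([weight1E], [weight2E]).  Together with [l^2 = 5 a^2 + 4] ([companionE]) this
gives the exact values
  [mean = n (l / a) / 5 + 2 / 5],
  [variance = 2 n (l / a) / 25 - 4 n^2 / (25 a^2) - 2 / 25].
The terms in [n^2] of the second moment and of the squared mean cancel up to
[n^2 / a^2], which is why the variance grows only linearly.  Since [a >= n],
both [1 / a] and [n / a^2] tend to 0, and [l / a = sqrt (5 + 4 / a^2)] tends to
[sqrt 5]; dividing by [n] gives the two limits. *)

(** * The linear recurrence for Q *)

(** Starting the recurrence at [0] instead of [Q 0 = 1] makes it hold from the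
first step on: [Q 2 = (2 + 'X) * Q 1], without the term [Q 0]. *)
Fixpoint Qlin (K : comNzRingType) (n : nat) : {poly K} :=
  match n with
  | 0 => 0
  | m.+1 => match m with
            | 0 => 'X
            | m'.+1 => (2 + 'X) * Qlin K m - Qlin K m'
            end
  end.

Lemma QlinSS (K : comNzRingType) n :
  Qlin K n.+2 = (2 + 'X) * Qlin K n.+1 - Qlin K n.
Proof. by []. Qed.

Lemma nat_ind2 (P : nat -> Prop) :
  P 0 -> P 1 -> (forall n, P n -> P n.+1 -> P n.+2) -> forall n, P n.
Proof.
move=> P0 P1 PSS n; suff [] : P n /\ P n.+1 by [].
by elim: n => // n [Pn PSn]; split=> //; exact: PSS.
Qed.

(** [Q] is ['X] times the convolution [W] of [Q] with the sequence [1, 2, ...];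
the first difference of that sequence is constant, so the second difference
of [W] is a single term of [Q]. *)
Lemma Q_Qlin n : Q n.+1 = Qlin int n.+1.
Proof.
pose W n : {poly int} := \sum_(j < n) (n - j)%:R * Q j.
have QW m : Q m.+1 = 'X * W m.+1.
  rewrite QE// big_add1 big_mkord [X in 'X * X](reindex_inj rev_ord_inj)/=.
  congr (_ * _); apply: eq_bigr => j _.
  by rewrite !subSS subKn ?leq_ord// subSn ?leq_ord.
have WS m : W m.+1 = W m + \sum_(j < m.+1) Q j.
  rewrite /W !big_ord_recr/= subSnn mul1r addrA -big_split/=; congr (_ + _).
  apply: eq_bigr => j _; rewrite subSn; last exact: ltnW.
  by rewrite -natr1 mulrDl mul1r.
have WSS m : W m.+2 = (2 + 'X) * W m.+1 - W m.
  rewrite WS big_ord_recr/= QW.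
  have -> : \sum_(j < m.+1) Q j = W m.+1 - W m by rewrite WS addrC addKr.
  by ring.
rewrite QW; suff WQ m : 'X * W m = Qlin int m by rewrite WQ.
elim/nat_ind2: m => [||m IH0 IH1]; first by rewrite /W big_ord0 mulr0.
- by rewrite /W big_ord1 subn0 Q0 !mulr1.
- by rewrite WSS QlinSS -IH0 -IH1; ring.
Qed.

Lemma map_Qlin (K : comNzRingType) n :
  map_poly intr (Qlin int n) = Qlin K n.
Proof.
elim/nat_ind2: n => [||n IH0 IH1]; rewrite ?rmorph0 ?map_polyX//.
by rewrite !QlinSS rmorphB rmorphM rmorphD/= IH0 IH1 map_polyX rmorph_nat.
Qed.

Lemma size_Qlin (K : comNzRingType) n : (size (Qlin K n) <= n.+1)%N.
Proof.
elim/nat_ind2: n => [||n IH0 IH1]; rewrite ?size_poly0 ?size_polyX//.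
have szX (p : {poly K}) (k : nat) :
    (size p <= k)%N -> (size (2 * p + 'X * p)%R <= k.+1)%N.
  move=> /leq_sizeP pk; apply/leq_sizeP => -[//|j] kj.
  by rewrite mulr_natl coefD coefMn coefXM/= !pk ?mul0rn ?addr0// ltnW.
apply/leq_sizeP => j nj; rewrite QlinSS coefB.
rewrite (leq_sizeP _ _ IH0) ?subr0; last by rewrite (leq_trans _ nj) 1?ltnW.
by rewrite mulrDl (leq_sizeP _ _ (szX _ _ IH1)).
Qed.

(** * The Euler operator *)

(** The operator [x d/dx] multiplies the coefficient of [x^i] by [i], so its
iterates, evaluated at 1, are the moments of the coefficients. *)
Definition euler {K : comNzRingType} (p : {poly K}) : {poly K} := 'X * p^`().

Lemma coef_euler (K : comNzRingType) (p : {poly K}) i :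
  (euler p)`_i = i%:R * p`_i.
Proof.
rewrite /euler coefXM; case: i => [|i]; first by rewrite mul0r.
by rewrite coef_deriv mulr_natl.
Qed.

Lemma size_euler {K : comNzRingType} (p : {poly K}) :
  (size (euler p) <= size p)%N.
Proof.
by apply/leq_sizeP => i /(nth_default 0) pi0; rewrite coef_euler pi0 mulr0.
Qed.

Lemma sum_coef {K : comNzRingType} {p : {poly K}} {n} : (size p <= n)%N ->
  \sum_(i < n) p`_i = p.[1].
Proof.
move=> /horner_coef_wide ->; apply: eq_bigr => i _.
by rewrite expr1n mulr1.
Qed.

Lemma eulerD (K : comNzRingType) (p q : {poly K}) :
  euler (p + q) = euler p + euler q.
Proof. by rewrite /euler derivD mulrDr. Qed.

(** The Euler operator is a derivation that kills 2 and fixes ['X], so it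
commutes with a step of the recurrence up to the extra term ['X * p]. *)
Lemma euler_step (K : comNzRingType) (p q : {poly K}) :
  euler ((2 + 'X) * p - q) = (2 + 'X) * euler p - euler q + 'X * p.
Proof.
rewrite /euler derivB derivM derivD derivX -polyC_natr derivC add0r.
by move: (deriv p) (deriv q) => p' q'; ring.
Qed.

Lemma eulerXM (K : comNzRingType) (p : {poly K}) :
  euler ('X * p) = 'X * euler p + 'X * p.
Proof.
rewrite /euler derivM derivX mul1r mulrDr addrC.
by congr (_ + _); rewrite mulrA.
Qed.

Lemma horner1_step (K : comNzRingType) (p q : {poly K}) :
  ((2 + 'X) * p - q).[1] = 3 * p.[1] - q.[1].
Proof. by rewrite !hornerE; ring. Qed.

Lemma horner1_XM (K : comNzRingType) (p : {poly K}) : ('X * p).[1] = p.[1].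
Proof. by rewrite hornerM hornerX mul1r. Qed.

(** * Closed forms for the moments *)

Section moments.
Variable K : comNzRingType.

(** The Fibonacci number [F_(2n)]. *)
Definition weight n : K := (Qlin K n).[1].
Definition weight1 n : K := (euler (Qlin K n)).[1].
Definition weight2 n : K := (euler (euler (Qlin K n))).[1].
(** The Lucas number [L_(2n)], in the form [2 F_(2n+2) - 3 F_(2n)]. *)
Definition companion n : K := 2 * weight n.+1 - 3 * weight n.

Lemma euler0 : euler (0 : {poly K}) = 0.
Proof. by rewrite /euler deriv0 mulr0. Qed.

Lemma eulerX : euler ('X : {poly K}) = 'X.
Proof. by rewrite /euler derivX mulr1. Qed.

Lemma weight_0 : weight 0 = 0.
Proof. exact: horner0. Qed.

Lemma weight_1 : weight 1 = 1.
Proof. exact: hornerX. Qed.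

Lemma weight1_0 : weight1 0 = 0.
Proof. by rewrite /weight1 euler0 horner0. Qed.

Lemma weight1_1 : weight1 1 = 1.
Proof. by rewrite /weight1 eulerX hornerX. Qed.

Lemma weight2_0 : weight2 0 = 0.
Proof. by rewrite /weight2 !euler0 horner0. Qed.

Lemma weight2_1 : weight2 1 = 1.
Proof. by rewrite /weight2 !eulerX hornerX. Qed.

Lemma weightSS n : weight n.+2 = 3 * weight n.+1 - weight n.
Proof. exact: horner1_step. Qed.

Lemma weight1SS n : weight1 n.+2 = 3 * weight1 n.+1 - weight1 n + weight n.+1.
Proof.
by rewrite /weight1 QlinSS euler_step hornerD horner1_step horner1_XM.
Qed.

Lemma weight2SS n :
  weight2 n.+2 =
    3 * weight2 n.+1 - weight2 n + 2 * weight1 n.+1 + weight n.+1.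
Proof.
rewrite /weight2 QlinSS euler_step eulerD euler_step eulerXM.
rewrite 2!hornerD horner1_step hornerD.
rewrite !(horner1_XM _ (euler _)) (horner1_XM _ (Qlin _ _)).
rewrite -!/(weight2 _) -!/(weight1 _) -/(weight _); ring.
Qed.

(** The difference [L^2 - 5 F^2] is 4 times Cassini's expression
[F_(2n+2)^2 - 3 F_(2n+2) F_(2n) + F_(2n)^2], which the recurrence preserves. *)
Lemma companionE n :
  companion n ^+ 2 = 5 * weight n ^+ 2 + 4.
Proof.
have cassini :
    weight n.+1 ^+ 2 - 3 * weight n.+1 * weight n + weight n ^+ 2 = 1.
  elim: n => [|n IH]; first by rewrite weight_0 weight_1; ring.
  by rewrite weightSS -[RHS]IH; ring.
rewrite /companion; transitivity (5 * weight n ^+ 2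
    + 4 * (weight n.+1 ^+ 2 - 3 * weight n.+1 * weight n + weight n ^+ 2)).
  by ring.
by rewrite cassini mulr1.
Qed.

(** The forcing term solves the homogeneous recurrence, so there is resonance:
a particular solution is [n * companion n / 5], because the recurrence operator
sends [n * companion n] to [5 * weight n.+1]. *)
Lemma weight1E n : 5 * weight1 n = n%:R * companion n + 2 * weight n.
Proof.
rewrite /companion; elim/nat_ind2: n => [||n IH0 IH1].
- by rewrite weight1_0 weight_0; ring.
- by rewrite weight1_1 weightSS weight_1 weight_0; ring.
have -> : 5 * weight1 n.+2 =
    3 * (5 * weight1 n.+1) - 5 * weight1 n + 5 * weight n.+1.
  by rewrite weight1SS; ring.
by rewrite IH0 IH1 !weightSS -!natr1; ring.
Qed.

(** Here the forcing terms already contain [n * companion n], which raises the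
resonance to [n ^+ 2 * weight n]. *)
Lemma weight2E n :
  25 * weight2 n =
    5 * n%:R ^+ 2 * weight n + 6 * n%:R * companion n + 2 * weight n.
Proof.
rewrite /companion; elim/nat_ind2: n => [||n IH0 IH1].
- by rewrite weight2_0 weight_0; ring.
- by rewrite weight2_1 weightSS weight_1 weight_0; ring.
have -> : 25 * weight2 n.+2 =
    3 * (25 * weight2 n.+1) - 25 * weight2 n + 10 * (5 * weight1 n.+1)
    + 25 * weight n.+1.
  by rewrite weight2SS; ring.
by rewrite weight1E IH0 IH1 /companion !weightSS -!natr1; ring.
Qed.

End moments.

(** The bound on the increments, carried along in the induction, is what gives
the linear lower bound. *)
Lemma weight_growth (R : realDomainType) n :
  n%:R <= weight R n /\ weight R n + 1 <= weight R n.+1.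
Proof.
elim: n => [|n [IH0 IH1]]; first by rewrite weight_1 weight_0; split; lra.
rewrite weightSS -natr1; have := ler0n R n; split; lra.
Qed.

(** The sign selects the root when [l / a] is recovered from its square. *)
Lemma companion_ge0 (R : realDomainType) n : 0 <= companion R n.
Proof.
rewrite /companion; case: n => [|n]; first by rewrite weight_1 weight_0; lra.
have [_ h0] := weight_growth R n; have [_ h1] := weight_growth R n.+1.
have [w0 _] := weight_growth R n; have := ler0n R n.
rewrite weightSS in h1 *; lra.
Qed.

(** * Mean and variance from a generating polynomial *)

(** A function of [X] is a finite combination of indicators of the level sets
of [X], whose integrals are given by the law. *)
Lemma integral_natvalued {d : measure_display} {T : measurableType d}
    {R : realType} {P : probability T R} {X : {RV P >-> R}} {n : nat}
    {p : nat -> R} (g : R -> R) :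
  (forall w, exists2 k, (k <= n)%N & X w = k%:R) ->
  (forall k, (k <= n)%N -> P (X @^-1` [set k%:R]) = (p k)%:E) ->
  (\int[P]_w (g (X w))%:E = (\sum_(k < n.+1) g k%:R * p k)%:E)%E.
Proof.
move=> X_values X_law.
have mX k : measurable (X @^-1` [set k%:R : R]).
  by rewrite -[X in measurable X]setTI; exact: measurable_funP.
have gX w : ((g (X w))%:E =
    \sum_(k < n.+1) (g k%:R)%:E * (\1_(X @^-1` [set k%:R]) w)%:E)%E.
  have [k kn Xw] := X_values w; have kn1 : (k < n.+1)%N by [].
  rewrite (bigD1 (Ordinal kn1))//= big1 ?adde0 => [|j /negPf jk].
    by rewrite Xw indicE mem_set// mule1.
  rewrite indicE memNset ?mule0//= Xw => /eqP; rewrite eqr_nat => /eqP kj.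
  by move: jk; rewrite -val_eqE/= kj eqxx.
under eq_integral do rewrite gX.
rewrite integral_sum//; last first.
  by move=> k; apply: integrableZl => //; exact: integrable_indic.
rewrite -sumEFin; apply: eq_bigr => k _.
rewrite integralZl//; last exact: integrable_indic.
rewrite integral_indic// setIT EFinM; congr (_ * _)%E.
by apply: X_law; rewrite -ltnS.
Qed.

Lemma mean_variance_coef {d : measure_display} {T : measurableType d}
    {R : realType} {P : probability T R} {X : {RV P >-> R}} {n : nat}
    {q : {poly R}} :
  (size q <= n.+1)%N -> q.[1] != 0 ->
  (forall w, exists2 k, (k <= n)%N & X w = k%:R) ->
  (forall k, (k <= n)%N -> P (X @^-1` [set k%:R]) = (q`_k / q.[1])%:E) ->
  ('E_P[X] = ((euler q).[1] / q.[1])%:E)%E /\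
  ('V_P[X] = ((euler (euler q)).[1] / q.[1]
             - ((euler q).[1] / q.[1]) ^+ 2)%:E)%E.
Proof.
move=> szq q1 X_values X_law.
have size1 := leq_trans (size_euler q) szq.
have size2 := leq_trans (size_euler (euler q)) size1.
set m0 := q.[1]; set m1 := (euler q).[1]; set m2 := (euler (euler q)).[1].
have EX : ('E_P[X] = (m1 / m0)%:E)%E.
  rewrite unlock (integral_natvalued id X_values X_law).
  rewrite /m1 -(sum_coef size1) mulr_suml; congr (_%:E).
  by apply: eq_bigr => k _; rewrite coef_euler mulrA.
split=> //; rewrite /variance unlock EX/= unlock.
pose g x : R := (x - m1 / m0) * (x - m1 / m0).
rewrite (integral_natvalued g X_values X_law); congr (_%:E).
transitivity ((m2 - 2 * (m1 / m0) * m1 + (m1 / m0) ^+ 2 * m0) / m0); last first.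
  by field.
have <- : \sum_(k < n.+1) k%:R * (k%:R * q`_k) = m2.
  rewrite /m2 -(sum_coef size2).
  by under [RHS]eq_bigr do rewrite !coef_euler.
have -> : 2 * (m1 / m0) * m1 = 2 * (m1 / m0) * \sum_(k < n.+1) k%:R * q`_k.
  congr (_ * _); rewrite /m1 -(sum_coef size1).
  by under eq_bigr do rewrite coef_euler.
have -> : (m1 / m0) ^+ 2 * m0 = (m1 / m0) ^+ 2 * \sum_(k < n.+1) q`_k.
  by rewrite sum_coef.
rewrite !mulr_sumr -sumrB -big_split mulr_suml.
by apply: eq_bigr => k _; rewrite /g/= /m0; field.
Qed.

Lemma A_coef (R : realType) n k : (A n.+1 k)%:~R = (Qlin R n.+1)`_k.
Proof. by rewrite /A Q_Qlin -(map_Qlin R) coef_map. Qed.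

(** * Asymptotics *)

Section asymptotics.
Variable R : realType.

Lemma weight_gt0 n : 0 < weight R n.+1.
Proof. by have [+ _] := weight_growth R n.+1; apply: lt_le_trans. Qed.

Lemma cvg_weightV : (weight R n.+1)^-1 @[n --> \oo] --> (0 : R).
Proof.
apply: (@squeeze_cvgr _ _ _ _ (fun=> 0) (@harmonic R)); last 2 first.
- exact: cvg_cst.
- exact: cvg_harmonic.
near=> n; rewrite invr_ge0 ltW ?weight_gt0//= lef_pV2 ?posrE ?weight_gt0//.
by have [] := weight_growth R n.+1.
Unshelve. all: by end_near. Qed.

Lemma cvg_natM_weightVX2 :
  n.+1%:R / weight R n.+1 ^+ 2 @[n --> \oo] --> (0 : R).
Proof.
apply: (squeeze_cvgr _ (cvg_cst 0) cvg_weightV).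
near=> n; have a0 := weight_gt0 n; have [an _] := weight_growth R n.+1.
rewrite divr_ge0 ?sqr_ge0//= ler_pdivrMr ?exprn_gt0//.
by rewrite expr2 mulrA mulVf ?mul1r ?gt_eqF.
Unshelve. all: by end_near. Qed.

(** By [companionE] the ratio is [sqrt (5 + 4 / a^2)] with [a = weight R n.+1],
and [1 / a] tends to 0. *)
Lemma cvg_ratio :
  companion R n.+1 / weight R n.+1 @[n --> \oo] --> (Num.sqrt 5 : R).
Proof.
have -> : (fun n => companion R n.+1 / weight R n.+1) =
    Num.sqrt \o (fun n => 5 + 4 * ((weight R n.+1)^-1 * (weight R n.+1)^-1)).
  apply/funext => n /=; have a0 := weight_gt0 n.
  rewrite -[LHS]ger0_norm ?divr_ge0 ?companion_ge0 1?ltW// -sqrtr_sqr.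
  by rewrite expr_div_n companionE; congr Num.sqrt; field; rewrite gt_eqF.
apply: continuous_cvg; first exact: sqrt_continuous.
rewrite -[X in _ --> X]addr0 -[X in _ --> _ + X](mulr0 4).
apply: cvgD; first exact: cvg_cst.
apply: cvgM; first exact: cvg_cst.
by rewrite -[X in _ --> X](mulr0 0); apply: cvgM; exact: cvg_weightV.
Qed.

End asymptotics.

(** For sequences such as the means and variances of random variables whose laws
are prescribed only from index 1 on: the value at 0 is arbitrary. *)
Lemma cvg_EFin_shift {R : realType} {u : nat -> \bar R} (v : nat -> R) {l : R} :
  (forall n, u n.+1 = (v n)%:E) -> v n @[n --> \oo] --> l ->
  u n @[n --> \oo] --> l%:E.
Proof.
move=> uv vl; rewrite -(cvg_shiftS u).
have -> : [sequence u n.+1]_n = EFin \o v by apply/funext.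
by apply: cvg_EFin; first exact: nearW.
Qed.

Theorem corollary1p7 (R : realType)
    (d : nat -> measure_display) (T : forall n : nat, measurableType (d n))
    (P : forall n : nat, probability (T n) R)
    (X : forall n : nat, {RV (P n) >-> R})
    (X_values : forall n : nat, (1 <= n)%N ->
       forall w : T n, exists2 k : nat, (k <= n)%N & X n w = k%:R)
    (X_law : forall n k : nat, (1 <= n)%N -> (k <= n)%N ->
       P n (X n @^-1` [set k%:R]) =
         ((A n k)%:~R / \sum_(0 <= m < n.+1) (A n m)%:~R)%:E) :
  [/\ ('E_(P n)[X n] * (n%:R^-1)%:E)%E @[n --> \oo]
        --> (2 / 5 * (golden_ratio - 1 / 2) : R)%:E,
      (2 / 5 * (golden_ratio - 1 / 2) : R) = 1 / Num.sqrt 5,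
      ('V_(P n)[X n] * (n%:R^-1)%:E)%E @[n --> \oo]
        --> (4 / 25 * (golden_ratio - 1 / 2) : R)%:E &
      (4 / 25 * (golden_ratio - 1 / 2) : R) = 2 / 5 * (1 / Num.sqrt 5)].
Proof.
have sqrt5 : Num.sqrt 5 ^+ 2 = 5 :> R by rewrite sqr_sqrtr.
have sqrt5_neq0 : Num.sqrt 5 != 0 :> R by rewrite sqrtr_eq0 -ltNge.
have golden : 2 / 5 * (golden_ratio - 1 / 2) = Num.sqrt 5 / 5 :> R.
  by rewrite /golden_ratio; field.
have golden4 : 4 / 25 * (golden_ratio - 1 / 2) = 2 / 25 * Num.sqrt 5 :> R.
  by rewrite /golden_ratio; field.
have sqrt5V : 1 / Num.sqrt 5 = Num.sqrt 5 / 5 :> R by rewrite -{3}sqrt5; field.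
have EV n := mean_variance_coef (X := X n.+1)
  (size_Qlin R n.+1) (lt0r_neq0 (weight_gt0 R n)) (X_values n.+1 isT).
have {}EV n : ('E_(P n.+1)[X n.+1] = (weight1 R n.+1 / weight R n.+1)%:E)%E /\
  ('V_(P n.+1)[X n.+1] = (weight2 R n.+1 / weight R n.+1
             - (weight1 R n.+1 / weight R n.+1) ^+ 2)%:E)%E.
  apply: EV => k kn; rewrite X_law//; congr (_ / _)%:E; first exact: A_coef.
  rewrite -(sum_coef (size_Qlin R n.+1)) big_mkord.
  by apply: eq_bigr => i _; exact: A_coef.
have w1E n : weight1 R n = (n%:R * companion R n + 2 * weight R n) / 5.
  by rewrite -weight1E; field.
have w2E n : weight2 R n =
    (5 * n%:R ^+ 2 * weight R n + 6 * n%:R * companion R n + 2 * weight R n)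
    / 25.
  by rewrite -weight2E; field.
have cvg_scale (c : R) (u : nat -> R) (v : R) :
    u n @[n --> \oo] --> v -> c * u n @[n --> \oo] --> c * v.
  by move=> uv; apply: cvgM => //; exact: cvg_cst.
split.
- rewrite golden.
  rewrite (_ : _ / 5 = 5^-1 * Num.sqrt 5 + 2 / 5 * 0); last by field.
  apply: (cvg_EFin_shift (fun n =>
      5^-1 * (companion R n.+1 / weight R n.+1) + 2 / 5 * harmonic n)) => [n|].
    rewrite (EV n).1 -EFinM w1E; congr _%:E.
    have a0 : weight R n.+1 != 0 by rewrite gt_eqF ?weight_gt0.
    by rewrite /harmonic/=; field; rewrite nat1r pnatr_eq0 a0.
  by apply: cvgD; apply: cvg_scale; [exact: cvg_ratio|exact: cvg_harmonic].
- by rewrite golden sqrt5V.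
- rewrite golden4.
  rewrite (_ : _ * _ = 2 / 25 * Num.sqrt 5 + (- 4 / 25 * 0 + - 2 / 25 * 0));
    last by rewrite !mulr0 !addr0.
  apply: (cvg_EFin_shift (fun n =>
      2 / 25 * (companion R n.+1 / weight R n.+1)
      + (- 4 / 25 * (n.+1%:R / weight R n.+1 ^+ 2) + - 2 / 25 * harmonic n)))
    => [n|].
    rewrite (EV n).2 -EFinM w1E w2E; congr _%:E.
    have l2 := companionE R n.+1.
    have a0 : weight R n.+1 != 0 by rewrite gt_eqF ?weight_gt0.
    have N0 : n.+1%:R != 0 :> R by rewrite pnatr_eq0.
    rewrite /harmonic/=.
    move: (weight R n.+1) (companion R n.+1) (n.+1%:R : R) l2 a0 N0.
    move=> a l N l2 a0 N0.
    (* Isolate [l ^+ 2]: its value [5 * a ^+ 2 + 4] cancels the leading term. *)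
    transitivity ((5 * N ^+ 2 * a ^+ 2 + 2 * N * l * a - 2 * a ^+ 2
                   - N ^+ 2 * l ^+ 2) / (25 * a ^+ 2 * N)).
      by field; rewrite N0.
    by rewrite l2; field; rewrite N0.
  apply: cvgD; first by apply: cvg_scale; exact: cvg_ratio.
  apply: cvgD; apply: cvg_scale.
  + exact: cvg_natM_weightVX2.
  + exact: cvg_harmonic.
- by rewrite golden4 sqrt5V; field.
Qed.
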